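(* Let $R$ be a commutative ring with $1\neq 0$ and let $Q$ be a proper ideal of $R$. Then the following conditions are equivalent: (1) $Q$ is a uniformly 2-absorbing primary ideal of $R$; (2) there exists a positive integer $n$ such that for every $a,b\in R$, either $(ab)^n\in Q$ or $(Q:_R ab)\subseteq (Q:_R a)\cup(\sqrt{Q}:_R b)$; (3) there exists a positive integer $n$ such that for every $a,b\in R$, either $(ab)^n\in Q$ or $(Q:_R ab)=(Q:_R a)$ or $(Q:_R ab)\subseteq(\sqrt{Q}:_R b)$; (4) there exists a positive integer $n$ such that for every $a,b\in R$ and every ideal $I$ of $R$, $abI\subseteq Q$ implies that either $aI\subseteq Q$ or $bI\subseteq\sqrt{Q}$ or $(ab)^n\in Q$; (5) there exists a positive integer $n$ such that for every $a,b\in R$, either $ab\in Q$ or $(Q:_R ab)^{[n]}\subseteq(\sqrt{Q}:_R a)\cup(Q:_R b^n)$; (6) there exists a positive integer $n$ such that for every $a,b\in R$, either $ab\in Q$ or $(Q:_R ab)^{[n]}\subseteq(\sqrt{Q}:_R a)$ or $(Q:_R ab)^{[n]}\subseteq(Q:_R b^n)$.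
   Context: All rings are commutative with $1\neq 0$. A proper ideal $Q$ of $R$ is uniformly 2-absorbing primary if there exists a positive integer $n$ such that whenever $a,b,c\in R$ satisfy $abc\in Q$, $ab\notin Q$ and $ac\notin\sqrt{Q}$, then $(bc)^n\in Q$. Here $\sqrt{Q}=\{r\in R : r^m\in Q \text{ for some positive integer } m\}$. For an ideal $I$ and $x\in R$, $(I:_R x)=\{r\in R : rx\in I\}$. For an ideal $I$ and a positive integer $n$, $I^{[n]}$ denotes the ideal of $R$ generated by the $n$-th powers of all elements of $I$. *)

(* Defs.v *)
From mathcomp Require Import all_boot all_algebra.
From mathcomp Require Import boolp classical_sets.
Set Implicit Arguments.
Unset Strict Implicit.
Unset Printing Implicit Defensive.
Import GRing.Theory.
Local Open Scope classical_set_scope.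
Local Open Scope ring_scope.

(* Ideals are Prop-valued sets: [idealr] of ring_quotient is restricted to
   proper ideals, whereas the unit ideal is needed as well (quantification over
   all ideals, colon ideals). The lemma [is_proper_idealP] gives the link. *)
Definition is_ideal (R : comNzRingType) (I : set R) : Prop :=
  [/\ I 0,
      forall x y, I x -> I y -> I (x + y)
    & forall r x, I x -> I (r * x)].

Definition is_proper_ideal (R : comNzRingType) (I : set R) : Prop :=
  is_ideal I /\ I <> [set: R].

Lemma is_proper_idealP (R : comNzRingType) (I : set R) :
  is_proper_ideal I <-> idealr_closed [in I].
Proof.
split=> [[[I0 ID IM] IT]|[I0 I1 IL]].
  split; first by rewrite inE.
  - apply/negP; rewrite inE => I1; apply: IT.
    by apply/seteqP; split=> // x _; rewrite -[x]mulr1; exact: IM.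
  - by move=> a x y; rewrite !inE => Ix Iy; apply: ID => //; exact: IM.
move: I0 I1; rewrite !inE => I0 I1.
have H a x y : I x -> I y -> I (a * x + y).
  by move=> Ix Iy; have := IL a x y; rewrite !inE; exact.
split; last by move=> IT; move/negP: I1; rewrite inE IT; apply.
split=> // [x y Ix Iy|r x Ix]; first by rewrite -[x]mul1r; exact: H.
by rewrite -[_ * _]addr0; exact: H.
Qed.

Definition radical (R : comNzRingType) (I : set R) : set R :=
  [set r | exists2 m : nat, (0 < m)%N & I (r ^+ m)].

Definition colon (R : comNzRingType) (I : set R) (x : R) : set R :=
  [set r | I (r * x)].

Definition ideal_generated (R : comNzRingType) (G : set R) : set R :=
  smallest (@is_ideal R) G.

(* I^[n], as opposed to the ordinary power I^n *)
Definition bracket_power (R : comNzRingType) (I : set R) (n : nat) : set R :=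
  ideal_generated [set x ^+ n | x in I].

Definition uniformly_2absorbing_primary (R : comNzRingType) (Q : set R) : Prop :=
  is_proper_ideal Q /\
  exists2 n : nat, (0 < n)%N &
    forall a b c : R, Q (a * b * c) -> ~ Q (a * b) -> ~ radical Q (a * c) ->
      Q ((b * c) ^+ n).

(* Main.v *)
Require Import Defs.
From mathcomp Require Import all_boot all_algebra.
From mathcomp Require Import boolp classical_sets.
Import GRing.Theory.
Local Open Scope classical_set_scope.
Local Open Scope ring_scope.

(** For fixed [a] and [b], the definition constrains each [c] in the ideal
    [colon Q (a * b)]: if [(a * b) ^+ n] is not in [Q], then [c] lies in
    [colon Q a] or in [colon (radical Q) b].  An ideal inside the union of two
    ideals lies in one of them ([ideal_sub_setU]), which turns this elementwise
    alternative into one about the whole colon ideal, then about any ideal [I]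
    with [a b I] inside [Q]; principal ideals [I] give back the definition.  All
    these steps keep the exponent [n].

    The delicate step is to reach the conditions on [bracket_power].  Suppose
    [a * b] is not in [Q] and put [J = colon Q (a * b)].  Every [c] in [J]
    satisfies [radical Q (a * c)] or [Q ((b * c) ^+ n)], but only the first
    alternative defines an ideal, so [ideal_sub_setU] does not apply; moreover
    [bracket_power J n] contains sums of powers [c ^+ n] of elements of both
    kinds.  The way out is to double the exponent.  If some [c0] in [J] violates
    the first alternative, then every [c] in [J] satisfying it is the difference
    of [c + c0] and [c0], which both violate it; hence [b * c] is a difference of
    two elements whose [n]-th powers are in [Q], and [(b * c) ^+ (n + n)] is in
    [Q] by the binomial formula.  So either the first alternative holds on all
    of [J], or the second one does with [n + n] in place of [n]
    ([colon_mul_dichotomy]).  This puts [bracket_power J (n + n)] inside one of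
    the two ideals, and a fortiori inside their union.

    Conversely, the inclusion of [bracket_power J n] in one of the two ideals is
    applied to the generator [c ^+ n]: from [radical Q (a * c ^+ n)] one gets
    [radical Q (a * c)] after multiplying by [a ^+ n.-1]. *)

(** * Ideals as sets *)

Section Ideals.
Set Implicit Arguments.
Unset Strict Implicit.
Variable R : comNzRingType.
Implicit Types (I J A B : set R) (a b c x y : R).

Lemma ideal0 I : is_ideal I -> I 0. Proof. by case. Qed.

Lemma idealD I x y : is_ideal I -> I x -> I y -> I (x + y).
Proof. by case=> _ + _; exact. Qed.

Lemma idealMl I r x : is_ideal I -> I x -> I (r * x).
Proof. by case=> _ _; exact. Qed.

Lemma idealMr I r x : is_ideal I -> I x -> I (x * r).
Proof. by move=> hI Ix; rewrite mulrC; exact: idealMl. Qed.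

Lemma idealB I x y : is_ideal I -> I x -> I y -> I (x - y).
Proof. by move=> hI Ix Iy; rewrite -mulN1r; apply: idealD => //; exact: idealMl. Qed.

Lemma ideal_expS I x m k : is_ideal I -> (m <= k)%N -> I (x ^+ m) -> I (x ^+ k).
Proof. by move=> hI /subnK <- Ix; rewrite exprD; exact: idealMl. Qed.

(** In each term of the binomial expansion of [(x + y) ^+ (m + k)], either the
    exponent of [x] is at least [m] or that of [y] is at least [k]. *)
Lemma ideal_expD I x y m k :
  is_ideal I -> I (x ^+ m) -> I (y ^+ k) -> I ((x + y) ^+ (m + k)).
Proof.
move=> hI Ix Iy; rewrite exprDn.
apply: big_ind => [|u v|i _]; [exact: ideal0 | exact: idealD |].
rewrite -mulr_natr; apply: idealMr => //.
have [le_ki|lt_ik] := leqP k i; first exact: idealMl (ideal_expS hI le_ki Iy).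
apply: idealMr => //; apply: ideal_expS Ix => //.
by rewrite -addnBA ?leq_addr // ltnW.
Qed.

Lemma ideal_expB I x y m k :
  is_ideal I -> I (x ^+ m) -> I (y ^+ k) -> I ((x - y) ^+ (m + k)).
Proof.
by move=> hI Ix Iy; apply: ideal_expD => //; rewrite exprNn; exact: idealMl.
Qed.

Lemma radical_ideal I : is_ideal I -> is_ideal (radical I).
Proof.
move=> hI; split=> [|x y [m m0 Ix] [k k0 Iy]|r x [m m0 Ix]].
- by exists 1%N; rewrite // expr1; exact: ideal0.
- by exists (m + k)%N; [rewrite addn_gt0 m0 | exact: ideal_expD].
- by exists m; rewrite // exprMn; exact: idealMl.
Qed.

Lemma radicalX I x n : (0 < n)%N -> radical I (x ^+ n) -> radical I x.
Proof.
by move=> n0 [m m0]; rewrite -exprM; exists (n * m)%N; rewrite // muln_gt0 n0.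
Qed.

Lemma colon_ideal I x : is_ideal I -> is_ideal (colon I x).
Proof.
move=> hI; split=> [|y z Iy Iz|r y Iy]; rewrite /colon /=.
- by rewrite mul0r; exact: ideal0.
- by rewrite mulrDl; exact: idealD.
- by rewrite -mulrA; exact: idealMl.
Qed.

Lemma colon_mulr I x y : is_ideal I -> colon I x `<=` colon I (x * y).
Proof. by move=> hI r; rewrite /colon /= mulrA; exact: idealMr. Qed.

Lemma principal_ideal c : is_ideal [set r * c | r in [set: R]].
Proof.
split=> [|_ _ [r _ <-] [s _ <-]|t _ [r _ <-]].
- by exists 0; rewrite ?mul0r.
- by exists (r + s); rewrite ?mulrDl.
- by exists (t * r); rewrite ?mulrA.
Qed.

Lemma ideal_generated_ideal (G : set R) : is_ideal (ideal_generated G).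
Proof.
split=> [I [hI _]|x y Gx Gy I hI|r x Gx I hI]; first exact: ideal0.
- by apply: idealD; [case: hI | exact: Gx | exact: Gy].
- by apply: idealMl; [case: hI | exact: Gx].
Qed.

Lemma bracket_power_sub I J n : is_ideal J ->
  (forall x, I x -> J (x ^+ n)) -> bracket_power I n `<=` J.
Proof. by move=> hJ IJ; apply: smallest_sub => // _ [x Ix <-]; exact: IJ. Qed.

Lemma mem_bracket_power I n x : I x -> bracket_power I n (x ^+ n).
Proof. by move=> Ix; apply: sub_gen_smallest; exists x. Qed.

(** If [x] in [J] avoids [B] and [y] in [J] avoids [A], then [x] lies in [A] and
    [y] in [B], so [x + y] can lie in neither. *)
Lemma ideal_sub_setU J A B : is_ideal J -> is_ideal A -> is_ideal B ->
  J `<=` A `|` B -> J `<=` A \/ J `<=` B.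
Proof.
move=> hJ hA hB JAB; apply: contrapT => /not_orP[].
move=> /existsNP[y /not_implyP[Jy nAy]] /existsNP[x /not_implyP[Jx nBx]].
have Ax : A x by case: (JAB x Jx).
have By : B y by case: (JAB y Jy).
case: (JAB (x + y) (idealD hJ Jx Jy)) => [Axy|Bxy].
- by apply: nAy; rewrite -[y](addKr x) addrC; exact: idealB.
- by apply: nBx; rewrite -[x](addrK y); exact: idealB.
Qed.

(** * Uniformly 2-absorbing primary ideals *)

(** The failure of the first inclusion at a single [c0] is enough to control every
    [c], because translating by [c0] moves [c] out of [colon (radical Q) a]; the
    exponent doubles since [b * c] is recovered as a difference. *)
Lemma colon_mul_dichotomy Q n a b : is_ideal Q ->
  (forall a b c, Q (a * b * c) -> ~ Q (a * b) -> ~ radical Q (a * c) ->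
     Q ((b * c) ^+ n)) ->
  ~ Q (a * b) ->
  colon Q (a * b) `<=` colon (radical Q) a \/
  forall c, colon Q (a * b) c -> Q ((b * c) ^+ (n + n)).
Proof.
move=> hQ absQ nQab; have hra := colon_ideal a (radical_ideal hQ).
have power c : colon Q (a * b) c -> ~ colon (radical Q) a c -> Q ((b * c) ^+ n).
  by rewrite /colon /= mulrC [c * a]mulrC => Jc; exact: absQ.
have [?|/existsNP[c0 /not_implyP[Jc0 nac0]]] :=
  pselect (colon Q (a * b) `<=` colon (radical Q) a); [by left | right].
move=> c Jc; have [ac|nac] := pselect (colon (radical Q) a c); last first.
  by apply: ideal_expS (power c Jc nac) => //; exact: leq_addr.
rewrite -[c](addrK c0) mulrBr; apply: ideal_expB (power c0 Jc0 nac0) => //.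
apply: power; first exact: idealD (colon_ideal _ hQ) Jc Jc0.
by move=> acc0; apply: nac0; rewrite -[c0](addKr c) addrC; exact: idealB.
Qed.

Lemma uniformly_2absorbing_primary_bracket Q :
  uniformly_2absorbing_primary Q ->
  exists2 n : nat, (0 < n)%N & forall a b,
    [\/ Q (a * b),
        bracket_power (colon Q (a * b)) n `<=` colon (radical Q) a
      | bracket_power (colon Q (a * b)) n `<=` colon Q (b ^+ n)].
Proof.
move=> [[hQ _] [n n0 absQ]]; exists (n + n)%N; first by rewrite addn_gt0 n0.
move=> a b; have [|nQab] := pselect (Q (a * b)); first by constructor 1.
have hra := colon_ideal a (radical_ideal hQ).
have [Ja|Jb] := colon_mul_dichotomy hQ absQ nQab.
- constructor 2; apply: bracket_power_sub => // c /Ja ac.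
  have: colon (radical Q) a (c ^+ 1) by [].
  by apply: ideal_expS => //; rewrite addn_gt0 n0.
- constructor 3; apply: bracket_power_sub => [|c /Jb]; first exact: colon_ideal.
  by rewrite /colon /= mulrC exprMn.
Qed.

Lemma bracket_uniformly_2absorbing_primary Q n : is_proper_ideal Q ->
  (0 < n)%N ->
  (forall a b,
    [\/ Q (a * b),
        bracket_power (colon Q (a * b)) n `<=` colon (radical Q) a
      | bracket_power (colon Q (a * b)) n `<=` colon Q (b ^+ n)]) ->
  uniformly_2absorbing_primary Q.
Proof.
move=> hQ n0 brQ; split=> //; exists n => // a b c Qabc nQab nrac.
have Jc : bracket_power (colon Q (a * b)) n (c ^+ n).
  by apply: mem_bracket_power; rewrite /colon /= mulrC.
case: (brQ a b) => [//|/(_ _ Jc) rac|/(_ _ Jc)]; last first.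
  by rewrite /colon /= exprMn mulrC.
have hr := radical_ideal (proj1 hQ).
case: nrac; apply: (radicalX n0).
have -> : (a * c) ^+ n = a ^+ n.-1 * (c ^+ n * a).
  by rewrite [c ^+ n * a]mulrC mulrA -exprSr prednK // exprMn.
exact: idealMl.
Qed.

Lemma colon_ideal_uniformly_2absorbing_primary Q n : is_proper_ideal Q ->
  (0 < n)%N ->
  (forall a b I, is_ideal I -> [set a * b * x | x in I] `<=` Q ->
    [\/ [set a * x | x in I] `<=` Q,
        [set b * x | x in I] `<=` radical Q
      | Q ((a * b) ^+ n)]) ->
  uniformly_2absorbing_primary Q.
Proof.
move=> hQ n0 idQ; split=> //; exists n => // a b c Qabc nQab nrac.
pose I := [set r * a | r in [set: R]].
have Ia : I a by exists 1; rewrite ?mul1r.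
(* The ideal is generated by [a], and not by [c], because the power that must
   be in [Q] is that of [b * c]. *)
case: (idQ b c I (principal_ideal a)) => //.
- move=> _ [_ [r _ <-] <-]; rewrite mulrCA [b * c * a]mulrC [a * _]mulrA.
  by apply: idealMl Qabc; case: hQ.
- by move=> /(_ (b * a)) bI; case: nQab; rewrite mulrC; apply: bI; exists a.
- by move=> /(_ (c * a)) cI; case: nrac; rewrite mulrC; apply: cI; exists a.
Qed.

End Ideals.

Theorem theorem2p13 (R : comNzRingType) (Q : set R) (hQ : is_proper_ideal Q) :
  [<-> uniformly_2absorbing_primary Q;
       exists2 n : nat, (0 < n)%N & forall a b : R,
         Q ((a * b) ^+ n) \/
         colon Q (a * b) `<=` colon Q a `|` colon (radical Q) b;
       exists2 n : nat, (0 < n)%N & forall a b : R,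
         [\/ Q ((a * b) ^+ n),
             colon Q (a * b) = colon Q a
           | colon Q (a * b) `<=` colon (radical Q) b];
       exists2 n : nat, (0 < n)%N & forall (a b : R) (I : set R),
         is_ideal I -> [set a * b * x | x in I] `<=` Q ->
         [\/ [set a * x | x in I] `<=` Q,
             [set b * x | x in I] `<=` radical Q
           | Q ((a * b) ^+ n)];
       exists2 n : nat, (0 < n)%N & forall a b : R,
         Q (a * b) \/
         bracket_power (colon Q (a * b)) n
           `<=` colon (radical Q) a `|` colon Q (b ^+ n);
       exists2 n : nat, (0 < n)%N & forall a b : R,
         [\/ Q (a * b),
             bracket_power (colon Q (a * b)) n `<=` colon (radical Q) a
           | bracket_power (colon Q (a * b)) n `<=` colon Q (b ^+ n)]].
Proof.
have [iQ _] := hQ; have irQ := radical_ideal iQ.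
tfae.
- move=> [_ [n n0 absQ]]; exists n => // a b.
  have [|nQab] := pselect (Q ((a * b) ^+ n)); [by left | right=> x xab].
  apply: contrapT => /not_orP[nxa nxb]; apply: nQab.
  by apply: absQ nxa nxb; rewrite -mulrA.
- move=> [n n0 subU]; exists n => // a b.
  have [|/ideal_sub_setU[||||]] := subU a b; first by constructor 1.
  + exact: colon_ideal.
  + exact: colon_ideal.
  + exact: colon_ideal.
  + by move=> sub; constructor 2; apply/seteqP; split=> //; exact: colon_mulr.
  + by constructor 3.
- move=> [n n0 colonQ]; exists n => // a b I _ abI.
  have IJ x : I x -> colon Q (a * b) x.
    by move=> Ix; rewrite /colon /= mulrC; apply: abI; exists x.
  case: (colonQ a b) => [|eqJ|subJ]; first by constructor 3.
  + by constructor 1 => _ [x /IJ Jx <-]; move: Jx; rewrite eqJ /colon /= mulrC.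
  + by constructor 2 => _ [x /IJ/subJ Jx <-]; rewrite mulrC.
(* The exponent changes only here, so this step goes through the definition
   rather than directly from one condition to the next. *)
- move=> [n n0 /(colon_ideal_uniformly_2absorbing_primary hQ n0)].
  move=> /uniformly_2absorbing_primary_bracket[m m0 brQ].
  exists m => // a b; case: (brQ a b) => [|sub|sub]; first by left.
  + by right=> x /sub; left.
  + by right=> x /sub; right.
- move=> [n n0 brU]; exists n => // a b.
  have [|/ideal_sub_setU[||||]] := brU a b; first by constructor 1.
  + exact: ideal_generated_ideal.
  + exact: colon_ideal.
  + exact: colon_ideal.
  + by constructor 2.
  + by constructor 3.
- by move=> [n n0 /(bracket_uniformly_2absorbing_primary hQ n0)].
Qed.
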